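(* Let $r, s \ge 2$ be multiplicatively dependent integers and let $m, \ell$ be the smallest positive integers such that $r^m = s^\ell$. Then there exist uncountably many real numbers $\xi$ satisfying $$\lim_{n \to +\infty} \bigl( p(n, \xi, r) + p(n, \xi, s) - 2n \bigr) = m + \ell,$$ and every irrational real number $\xi$ satisfies $$\lim_{n \to +\infty} \bigl( p(n, \xi, r) + p(n, \xi, s) - 2n \bigr) \ge m + \ell.$$
   Context: Two positive integers $x, y$ are multiplicatively independent if the only pair of integers $(i,j)$ with $x^i y^j = 1$ is $(0,0)$; otherwise they are multiplicatively dependent. For an integer $b \ge 2$ and a real number $\xi$, write $\xi = \lfloor \xi \rfloor + \sum_{k \ge 1} a_k b^{-k}$, where each $a_k \in \{0, 1, \ldots, b-1\}$ and infinitely many $a_k$ are not equal to $b-1$. The sequence $(a_k)_{k\ge 1}$ is uniquely determined; it is called the $b$-ary expansion of $\xi$ and is viewed as the infinite word $\mathbf a = a_1 a_2 \ldots$ over $\{0, 1, \ldots, b-1\}$. For a positive integer $n$, $p(n, \xi, b) := \mathrm{Card}\{a_{j+1} \ldots a_{j+n} : j \ge 0\}$ is the number of distinct blocks of $n$ consecutive digits in the $b$-ary expansion of $\xi$. The limit is taken in $\mathbb{R} \cup \{+\infty\}$. *)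

(* Defs.v *)
From HB Require Import structures.
From mathcomp Require Import all_boot all_order all_algebra finmap.
From mathcomp Require Import all_classical all_reals all_analysis.

Set Implicit Arguments.
Unset Strict Implicit.
Unset Printing Implicit Defensive.

Import Order.TTheory GRing.Theory Num.Theory.
Import numFieldNormedType.Exports.

Local Open Scope classical_set_scope.
Local Open Scope ring_scope.

Definition mult_independent (x y : nat) : Prop :=
  forall i j : int, x%:R ^ i * y%:R ^ j = 1 :> rat -> i = 0 /\ j = 0.

Definition mult_dependent (x y : nat) : Prop := ~ mult_independent x y.

(* Digits are indexed from 0: [a k] is the coefficient of b^-(k+1). *)
Definition is_expansion (R : realType) (b : nat) (xi : R) (a : nat -> nat) :
    Prop :=
  [/\ forall k, (a k < b)%N,
      infinite_set [set k | a k <> b.-1] &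
      series (fun k => (a k)%:R / b%:R ^+ k.+1 : R) @ \oo
        --> xi - (Num.floor xi)%:~R].

(* For b >= 2 exactly one word satisfies [is_expansion b xi]; the default
   value of [xget] only matters for b < 2. *)
Definition expansion (R : realType) (b : nat) (xi : R) : nat -> nat :=
  xget (fun=> 0%N) [set a | is_expansion b xi a].

Definition blocks (a : nat -> nat) (n : nat) : set (seq nat) :=
  [set w | exists j, w = mkseq (fun i => a (j + i)%N) n].

(* [fset_set] is meaningful only for finite sets; there are at most b ^ n
   blocks of length n when the digits of [a] are less than b. *)
Definition complexity (R : realType) (n : nat) (xi : R) (b : nat) : nat :=
  #|` fset_set (blocks (expansion b xi) n)|.

Definition complexity_excess (R : realType) (r s : nat) (xi : R) (n : nat) :
    \bar R :=
  ((complexity n xi r)%:R + (complexity n xi s)%:R - (2 * n)%N%:R)%:E.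

(* Main.v *)
Require Import Defs.
From HB Require Import structures.
From mathcomp Require Import all_boot all_order all_algebra finmap.
From mathcomp Require Import all_classical all_reals all_analysis.
From mathcomp Require Import zify lra.

(** Minimality of m and l makes them coprime, hence r = t ^ l and s = t ^ m for
    some t ([common_root]).  Let x be the base t expansion of xi.  A digit of xi
    in base t ^ q codes q consecutive letters of x, so the blocks of length n in
    base t ^ q are the windows of length q * n of x at the positions divisible
    by q ([complexity_chunk]); write A_q(n) for their number.  The statement
    thus concerns A_l(n) + A_m(n) - 2n for one word x.

    Lower bound.  If x is not ultimately periodic, then A_q(n+1) > A_q(n)
    ([win_growth]), so the excess is nondecreasing and it is enough to find one
    n where it is at least m + l.  If there is none, A_l(n) - n and A_m(n) - n
    are both bounded.  The key point ([synchronisation]) is that boundedness of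
    A_q(n) - n forces long windows of x to determine their position modulo q.
    To see this, compare the windows of length N with the windows of length N
    labelled by their position mod q.  There are at least N + 1 of the former
    and at most N + B of the latter, so at most B windows of each length occur
    at two residues.  Moreover, as the number of windows is N + O(1), from some
    length on there is at most one right special window, i.e. one that two
    different letters can follow.  A long window with two residues has only such
    windows inside it, so by pigeonhole it is periodic, with a period dividing
    B!.  But a word with at most one right special window per length has no long
    runs of a given period h ([bounded_runs]): the window before the end of such
    a run is right special, so every special window has period h; two equal long
    windows at places where the period h breaks then have the same
    continuation for ever, and x would be ultimately periodic.  Finally, by
    coprimality the windows at l * c are told apart by c mod m, and the windows
    of length l * m * k at each of the m residues number at least k + 1.  Thus
    A_l(m * k) >= m * k + m, and symmetrically A_m(l * k) >= l * k + l.

    Equality.  Let y be a Sturmian word with letters 0 and 1, and let x be y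
    with l * m - 1 zeros inserted before each letter.  A window of length l * n
    of x at l * c sees, when c = i mod m, exactly the letters of a window of y
    of length floor ((n + i) / m).  Hence A_l(n) is at most the sum of
    floor ((n + i) / m) + 1 for i < m, which is n + m.  By the lower bound the
    limit is exactly m + l.  The words y(k) = floor ((k+1) al) - floor (k al),
    for al irrational in ]0, 1[, provide uncountably many such xi. *)

Set Implicit Arguments.
Unset Strict Implicit.
Unset Printing Implicit Defensive.

Import Order.TTheory GRing.Theory Num.Theory.
Import numFieldNormedType.Exports.

Local Open Scope classical_set_scope.

(** * Counting values *)

(** Every complexity below is the number of values of a function of the
    position in a word.  Two of them are compared through the relations that
    the functions induce on positions, without looking at the values. *)
Definition nvals (K : choiceType) (f : nat -> K) : nat :=
  #|` fset_set (range f)|.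

Lemma mem_vals (K : choiceType) (f : nat -> K) (w : K) :
  finite_set (range f) -> reflect (exists i, f i = w) (w \in fset_set (range f)).
Proof.
move=> ff; rewrite in_fset_set//.
apply: (iffP idP) => [/set_mem[i _ <-]|[i <-]]; first by exists i.
by apply/mem_set; exists i.
Qed.

(** The value [g i] is a function of [f (s i)], so [g] has no more values. *)
Lemma nvals_le (K K' : choiceType) (f : nat -> K) (g : nat -> K')
    (s : nat -> nat) :
  finite_set (range f) -> (forall i j, f (s i) = f (s j) -> g i = g j) ->
  finite_set (range g) /\ nvals g <= nvals f.
Proof.
move=> ff fg.
pose phi w := g (xget 0 [set i | f (s i) = w]).
have phiE i : phi (f (s i)) = g i.
  rewrite /phi; case: xgetP => [j -> /fg //|/(_ i)]; by case.
have gf : finite_set (range g).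
  apply: (@sub_finite_set _ _ (phi @` range f)); last exact: finite_image.
  by move=> _ [i _ <-]; exists (f (s i)); [exists (s i)|exact: phiE].
split=> //.
apply: (@leq_trans #|` [fset phi w | w in fset_set (range f)]%fset|); last first.
  exact: leq_imfset_card.
apply/fsubset_leq_card/fsubsetP => w /(mem_vals _ gf)[i <-].
apply/imfsetP; exists (f (s i)); last by rewrite phiE.
by apply/(mem_vals _ ff); exists (s i).
Qed.

(** When [f] refines [g] with at most [E] extra values, at most [E] values of
    [g] can split into several values of [f]: one value of [f] for each value of
    [g], plus one more for each that splits, are pairwise distinct.  Thus [E + 1]
    instances of splitting involve a repeated value of [g].  The case [E = 0]
    says that [g] determines [f]; with [f] and [g] the windows of lengths [N + 1]
    and [N], the case [E = 1] says that at most one window is right special. *)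
Lemma nvals_split (K K' : choiceType) (f : nat -> K) (g : nat -> K')
    (E : nat) (i j : nat -> nat) :
  finite_set (range f) -> (forall a b, f a = f b -> g a = g b) ->
  nvals f <= nvals g + E ->
  (forall a, a <= E -> g (i a) = g (j a) /\ f (i a) <> f (j a)) ->
  exists a b, [/\ a < b, b <= E & g (i a) = g (i b)].
Proof.
move=> ff fg le ij; apply: contrapT => Hn.
have [gf _] := @nvals_le _ _ f g id ff fg.
pose rep w := xget 0 [set k | g k = w].
have repK k : g (rep (g k)) = g k.
  rewrite /rep; case: xgetP => [? -> //|/(_ k)]; by case.
(* Of the two values of [f] over [g (i a)], take one that is not the value at
   the representative. *)
pose s a := if f (i a) == f (rep (g (i a))) then f (j a) else f (i a).
pose l1 := [seq f (rep w) | w <- fset_set (range g)].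
pose l2 := [seq s a | a <- iota 0 E.+1].
have sE a : a <= E -> exists2 k, s a = f k & g k = g (i a).
  move=> /ij[gij _]; rewrite /s; case: ifP => _; first by exists (j a).
  by exists (i a).
have sN a : a <= E -> s a <> f (rep (g (i a))).
  move=> /ij[_ fij]; rewrite /s; case: eqP => [<- /esym//|//].
have inj a b : a <= E -> b <= E -> s a = s b -> a = b.
  move=> aE bE sab.
  have [k ska gka] := sE a aE; have [k' skb gkb] := sE b bE.
  have gab : g (i a) = g (i b) by rewrite -gka -gkb; apply: fg; rewrite -ska -skb.
  case: (ltngtP a b) => // lt; exfalso; apply: Hn; first by exists a, b.
  by exists b, a.
have u : uniq (l1 ++ l2).
  rewrite cat_uniq; apply/and3P; split.
  - rewrite map_inj_in_uniq ?fset_uniq// => w w'.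
    move=> /(mem_vals _ gf)[k <-] /(mem_vals _ gf)[k' <-] /fg.
    by rewrite !repK.
  - apply/hasPn => z /mapP[a]; rewrite mem_iota/= add0n ltnS => aE -> {z}.
    apply/negP => /mapP[_ /(mem_vals _ gf)[k <-]] sa.
    have [k' sk' gk'] := sE a aE.
    apply: (sN a aE); rewrite sa; congr (f (rep _)).
    by rewrite -gk' -(repK k); apply: fg; rewrite -sa.
  - rewrite map_inj_in_uniq ?iota_uniq// => a b.
    by rewrite !mem_iota !ltnS/=; apply: inj.
have : size (l1 ++ l2) <= size (fset_set (range f)).
  apply: uniq_leq_size => // w; rewrite mem_cat => /orP[] /mapP[].
    by move=> w' _ ->; apply/(mem_vals _ ff); exists (rep w').
  move=> a; rewrite mem_iota/= add0n ltnS => /sE[k sk _] ->.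
  by apply/(mem_vals _ ff); exists k; rewrite sk.
rewrite size_cat !size_map size_iota.
by move: le; rewrite /nvals; lia.
Qed.

Lemma nvals_residues (K : choiceType) (h : nat -> K) (q : nat) : 0 < q ->
  finite_set (range h) ->
  finite_set (range (fun k => (h k, k %% q))) /\
  nvals (fun k => (h k, k %% q)) = \sum_(i < q) nvals (fun k => h (q * k + i)).
Proof.
move=> q0 fh; set p := fun k => _.
have fp : finite_set (range p).
  apply: (@sub_finite_set _ _ (range h `*` `I_q)).
    by move=> _ [k _ <-]; split=> /=; [exists k|rewrite ltn_mod].
  by apply: finite_setX.
split=> //; rewrite /nvals.
have -> : #|` fset_set (range p)|
    = \sum_(u <- fset_set (range p)) \sum_(i < q) (u.2 == i :> nat).
  rewrite -sum1_size !big_seq; apply: eq_bigr => _ /(mem_vals _ fp)[k <-] /=.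
  have kq : k %% q < q by rewrite ltn_mod.
  rewrite (bigD1 (Ordinal kq))//= eqxx big1// => i /eqP ik.
  by case: eqP => // e; exfalso; apply: ik; apply: val_inj.
rewrite exchange_big/=; apply: eq_bigr => i _.
have fi : finite_set (range (fun k => h (q * k + i))).
  by apply: sub_finite_set fh => _ [k _ <-]; eexists.
rewrite -sum1_size -big_mkcond/= -big_filter !sum1_size.
rewrite -(size_map fst); apply: perm_size; apply: uniq_perm.
- rewrite map_inj_in_uniq ?filter_uniq ?fset_uniq//.
  move=> [a b] [c d]; rewrite !mem_filter /= => /andP[/eqP-> _] /andP[/eqP-> _].
  by move=> ->.
- exact: fset_uniq.
- move=> w; apply/mapP/(mem_vals _ fi) => [[[a b]]|[k <-]].
    rewrite mem_filter /= => /andP[/eqP-> /(mem_vals _ fp)[k [<- ki]] ->].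
    by exists (k %/ q); rewrite mulnC -ki -divn_eq.
  exists (h (q * k + i), i : nat) => //; rewrite mem_filter/= eqxx/=.
  apply/(mem_vals _ fp); exists (q * k + i); rewrite /p; congr pair.
  by rewrite mulnC modnMDl modn_small.
Qed.

(** * Windows of a word *)

Definition win (x : nat -> nat) (k N : nat) : seq nat :=
  mkseq (fun i => x (k + i)) N.

Definition ev_periodic (x : nat -> nat) : Prop :=
  exists n h, 0 < h /\ forall k, n <= k -> x (k + h) = x k.

Lemma win_eqP (x x' : nat -> nat) (k k' N : nat) :
  win x k N = win x' k' N <-> forall i, i < N -> x (k + i) = x' (k' + i).
Proof.
split=> [e i iN|e]; last first.
  by apply/eq_in_map => i; rewrite mem_iota => /andP[_]; apply: e.
by have := congr1 (fun s => nth 0 s i) e; rewrite !nth_mkseq.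
Qed.

Lemma win_sub (x : nat -> nat) (k k' N a M : nat) : a + M <= N ->
  win x k N = win x k' N -> win x (k + a) M = win x (k' + a) M.
Proof.
move=> aMN /win_eqP e; apply/win_eqP => i iM; rewrite -!addnA; apply: e; lia.
Qed.

Lemma finite_win (x : nat -> nat) (t N : nat) (u : nat -> nat) :
  (forall k, x k < t) -> finite_set (range (fun k => win x (u k) N)).
Proof.
move=> xt.
apply: (@sub_finite_set _ _
   ((fun w : N.-tuple 'I_t => [seq nat_of_ord i | i <- w]) @` setT)).
  move=> _ [k _ <-].
  exists [tuple Ordinal (xt (u k + i)) | i < N] => //=.
  by rewrite -map_comp /win /mkseq -val_enum_ord -map_comp.
by apply: finite_image; apply: finite_finset.
Qed.

(** Pigeonhole on an infinite set of positions. *)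
Lemma finite_collision (K : Type) (f : nat -> K) (D : set nat) :
  finite_set (range f) -> infinite_set D ->
  exists a b, [/\ a < b, D a, D b & f a = f b].
Proof.
move=> ff; apply: contra_notP => H.
suff inj : {in D &, injective f}.
  rewrite -(eq_finite_set (inj_card_eq inj)); apply: sub_finite_set ff => _ [i _ <-].
  by exists i.
move=> a b /set_mem Da /set_mem Db fab.
case: (ltngtP a b) => // lt; exfalso; apply: H; first by exists a, b.
by exists b, a.
Qed.

Lemma finite_nat_bounded (D : set nat) :
  finite_set D -> exists n, forall k, n <= k -> ~ D k.
Proof.
move=> /finite_seqP[s ->]; exists (\max_(i <- s) i).+1 => k lt ks.
by have : k <= \max_(i <- s) i; [exact: leq_bigmax_seq|rewrite leqNgt lt].
Qed.

Lemma not_ev_periodic_infinite (x : nat -> nat) (h : nat) :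
  ~ ev_periodic x -> 0 < h -> infinite_set [set k | x k <> x (k + h)].
Proof.
move=> nx h0 /finite_nat_bounded[n nk]; apply: nx.
by exists n, h; split=> // k /nk /contrapT /esym.
Qed.

Section Words.
Variables (x : nat -> nat) (t : nat).
Hypotheses (xt : forall k, x k < t) (nx : ~ ev_periodic x).

(** Morse and Hedlund's argument along the progression [q * k + j]: were there
    no new windows, the next [q] letters would be a function of the previous
    [N], and a repeated window would make the word ultimately periodic. *)
Lemma win_growth (q j N : nat) : 0 < q ->
  nvals (fun k => win x (q * k + j) N) <
  nvals (fun k => win x (q * k + j) (N + q)).
Proof.
move=> q0; rewrite ltnNge; apply/negP => le.
set g := fun k => win x _ N in le; set f := fun k => win x _ (N + q) in le.
have ff : finite_set (range f) := finite_win _ _ xt.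
have fg : finite_set (range g) := finite_win _ _ xt.
have fgE a b : f a = f b -> g a = g b.
  by move=> /(@win_sub _ _ _ _ 0 N); rewrite !addn0; apply; lia.
have gfE a b : g a = g b -> f a = f b.
  move=> gab; apply: contrapT => fab.
  have le0 : nvals f <= nvals g + 0 by rewrite addn0.
  have [] := @nvals_split _ _ f g 0 (fun=> a) (fun=> b) ff fgE le0.
    by move=> ? _.
  by move=> c [d [? ? _]]; lia.
have [a [b [ab _ _ gab]]] := finite_collision fg infinite_nat.
have gS c : g (a + c) = g (b + c).
  elim: c => [|c IH]; first by rewrite !addn0.
  have := win_sub (eq_leq (addnC q N)) (gfE _ _ IH).
  by rewrite /g; congr (win _ _ _ = win _ _ _); lia.
apply: nx; exists (q * a + j), (q * (b - a)).
split; first by rewrite muln_gt0 q0 subn_gt0.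
move=> k le_k; set i := k - (q * a + j).
have /gfE/win_eqP/(_ (i %% q)) := gS (i %/ q).
have := divn_eq i q; have := ltn_pmod i q0.
move=> iq iE H; symmetry; have {H} := H ltac:(lia).
have -> : q * (a + i %/ q) + j + i %% q = k by rewrite mulnDr; lia.
suff -> : q * (b + i %/ q) + j + i %% q = k + q * (b - a) by [].
have qab : q * a <= q * b by rewrite leq_mul2l (ltnW ab) orbT.
by rewrite mulnDr mulnBr; lia.
Qed.

Lemma win_growth_mul (q j k : nat) : 0 < q ->
  k < nvals (fun c => win x (q * c + j) (q * k)).
Proof.
move=> q0; elim: k => [|k IH]; last first.
  by rewrite mulnS addnC; apply: leq_trans (win_growth _ _ q0).
rewrite cardfs_gt0; apply/fset0Pn; exists (win x (q * 0 + j) (q * 0)).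
by apply/mem_vals; [exact: finite_win|exists 0].
Qed.

Lemma win_growth1 (N : nat) : nvals (win x ^~ N) < nvals (win x ^~ N.+1).
Proof.
have := @win_growth 1 0 N isT; rewrite addn1.
under eq_fun do rewrite mul1n addn0.
by under [X in _ < nvals X]eq_fun do rewrite mul1n addn0.
Qed.

Lemma win_growth1_mul (N : nat) : N < nvals (win x ^~ N).
Proof.
have := @win_growth_mul 1 0 N isT; rewrite mul1n.
by under eq_fun do rewrite mul1n addn0.
Qed.

(** A window of length [N] is right special when two different letters can
    follow it; from length [N0] on, there is at most one of each length. *)
Definition unique_special (N0 : nat) : Prop := forall N i j i' j', N0 <= N ->
  win x i N = win x j N -> x (i + N) <> x (j + N) ->
  win x i' N = win x j' N -> x (i' + N) <> x (j' + N) -> win x i N = win x i' N.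

Lemma win_eqS (i j N : nat) : win x i N = win x j N -> x (i + N) = x (j + N) ->
  win x i N.+1 = win x j N.+1.
Proof.
move=> /win_eqP e eN; apply/win_eqP => k; rewrite ltnS leq_eqVlt => /orP[/eqP->//|].
exact: e.
Qed.

(** If runs of period [h] were unbounded, the special window of every length
    would have period [h], being the one before the end of such a run.  Then a
    window that starts at a break of the period and is long enough to
    show the break is never special, so it determines all that follows.  There
    are infinitely many breaks and finitely many windows, so two breaks have the
    same continuation. *)
Lemma bounded_runs (N0 h : nat) : unique_special N0 -> 0 < h ->
  exists M, forall k, exists2 i, i < M & x (k + i) <> x (k + i + h).
Proof.
move=> us h0; apply: contrapT => H.
have run M : exists k, forall i, i < M -> x (k + i) = x (k + i + h).
  apply: contrapT => HM; apply: H; exists M => k; apply: contrapT => Hk.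
  apply: HM; exists k => i iM; apply: contrapT => Hi; apply: Hk; by exists i.
have per N i j : N0 <= N -> win x i N = win x j N -> x (i + N) <> x (j + N) ->
    forall a, a + h < N -> x (i + a) = x (i + a + h).
  move=> N0N wij nij a aN; have [k kN] := run N.
  have : exists e, x (k + e) != x (k + e + h).
    apply: contrapT => He; apply: nx; exists k, h; split=> // c kc.
    apply: contrapT => Hc; apply: He; exists (c - k); apply/eqP => e.
    by apply: Hc; rewrite -(subnKC kc) -e.
  (* [k + e] is where the run that starts at [k] ends. *)
  move=> /ex_minnP[e /eqP ne emin].
  have lt c : c < e -> x (k + c) = x (k + c + h).
    by move=> ce; apply/eqP; apply: contraTT ce => /emin; rewrite -leqNgt.
  have Ne : N <= e by rewrite leqNgt; apply/negP => /kN.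
  have wE : win x (k + e + h - N) N = win x (k + e - N) N.
    apply/win_eqP => c cN.
    have := lt (e - N + c) ltac:(lia).
    by move=> eq; symmetry; move: eq; congr (x _ = x _); lia.
  have nE : x (k + e + h - N + N) <> x (k + e - N + N).
    by move=> eq; apply: ne; move: eq => /esym; congr (x _ = x _); lia.
  have /win_eqP wi := us _ _ _ _ _ N0N wij nij wE nE.
  rewrite -addnA !wi; [|lia..].
  have := lt (e + h - N + a) ltac:(lia).
  by congr (x _ = x _); lia.
have [a [b [ab Da Db wab]]] := finite_collision
  (@finite_win x t (N0 + h).+1 id xt) (not_ev_periodic_infinite nx h0).
have wN N : win x a ((N0 + h).+1 + N) = win x b ((N0 + h).+1 + N).
  elim: N => [|N IH]; first by rewrite addn0.
  rewrite addnS; apply: win_eqS => //; apply: contrapT => ne.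
  apply: Da; have := per _ _ _ _ IH ne 0; rewrite !addn0; apply; lia.
apply: nx; exists a, (b - a); split; first by rewrite subn_gt0.
move=> k ak; have /win_eqP/(_ (k - a)) := wN (k - a).
by move=> /(_ ltac:(lia)) /esym; congr (x _ = x _); lia.
Qed.


(** * Bounded excess synchronises windows with residues *)

(** Only boundedly many windows of each length occur at two residues mod [q],
    because labelling windows by residues creates a bounded number [B] of new
    values.  An ambiguous window of length [N + B] contains [B + 1] ambiguous
    windows of length [N]; two of them coincide, which gives a run of a period
    dividing [B`!]. *)
Lemma synchronisation (q C : nat) : 0 < q ->
  (forall n, nvals (fun k => win x (q * k) (q * n)) <= n + C) ->
  exists N, forall a b, win x a N = win x b N -> a = b %[mod q].
Proof.
move=> q0 AC; pose B := 2 * q + q * C.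
pose p N k := (win x k N, k %% q).
have pfin N : finite_set (range (p N)).
  by have [] := nvals_residues q0 (@finite_win x t N id xt).
have pB N : nvals (p N) <= N + B.
  (* Windows at the last multiple of [q] up to [k], long enough to contain
     the window of length [N] at [k]. *)
  set n := N %/ q + 2; pose h k := win x (q * (k %/ q)) (q * n).
  have [hfin hsum] :=
    nvals_residues q0 (finite_win (q * n) (fun k => q * (k %/ q)) xt).
  apply: (@leq_trans (nvals (fun k => (h k, k %% q)))).
    apply: (@nvals_le _ _ _ _ id hfin _).2 => a b [hab ab].
    congr pair => //.
    have posE c : q * (c %/ q) + c %% q = c by rewrite mulnC -divn_eq.
    rewrite -(posE a) -(posE b) -ab; apply: win_sub hab; rewrite /n mulnDr.
    by have := divn_eq N q; have := ltn_pmod a q0; have := ltn_pmod N q0; lia.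
  rewrite hsum; apply: (@leq_trans (\sum_(i < q) (n + C))).
    apply: leq_sum => i _.
    rewrite (_ : (fun k => _) = fun k => win x (q * k) (q * n))//.
    by apply/funext => k; rewrite /h [q * k]mulnC divnMDl// divn_small// addn0 mulnC.
  rewrite sum_nat_const card_ord /n /B !mulnDr.
  by have := divn_eq N q; lia.
have wB N : nvals (win x ^~ N) <= N + B.
  apply: leq_trans (pB N); apply: (@nvals_le _ _ _ _ id (pfin N) _).2.
  by move=> a b [].
have [N0 slow] : exists N0, forall N, N0 <= N ->
    nvals (win x ^~ N.+1) <= nvals (win x ^~ N) + 1.
  apply: contrapT => H.
  have : exists N, N + B < nvals (win x ^~ N).
    elim: {pB wB} (B : nat) => [|c [N IH]].
      by exists 0; rewrite addn0; exact: win_growth1_mul.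
    apply: contrapT => H'; apply: H; exists N => N' NN'.
    rewrite leqNgt; apply/negP => lt; apply: H'; exists N'.+1.
    have : N' + c < nvals (win x ^~ N'); last lia.
    rewrite -(subnKC NN'); elim: (N' - N) => [|d IHd]; first by rewrite addn0.
    by rewrite addnS; have := win_growth1 (N + d); lia.
  by move=> [N]; rewrite ltnNge wB.
have us : unique_special N0.
  move=> N i j i' j' N0N wij nij wij' nij'.
  have [||||a [b []]] := @nvals_split _ _ (win x ^~ N.+1) (win x ^~ N) 1
      (fun a => if a is 0 then i else i') (fun a => if a is 0 then j else j').
  - exact: (finite_win _ id xt).
  - move=> a b /(@win_sub _ _ _ _ 0 N); rewrite !addn0; apply; lia.
  - exact: slow.
  - case=> [|a] _ /=; split=> // /win_eqP/(_ N (ltnSn _)) //.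
  - by case: a b => [|a] [|[|b]].
apply: contrapT => H.
have [M runM] := bounded_runs us (fact_gt0 B).
(* Room for a run of length [M] and period [B`!]. *)
pose N := M + B`!.
have [a [b [wab ab]]] : exists a b,
    win x a (N + B) = win x b (N + B) /\ a <> b %[mod q].
  apply: contrapT => H'; apply: H; exists (N + B) => a b wab.
  by apply: contrapT => ab; apply: H'; exists a, b.
have [||||i [j []]] := @nvals_split _ _ (p N) (win x ^~ N) B
    (fun i => a + i) (fun i => b + i).
- exact: pfin.
- by move=> c d [].
- by apply: leq_trans (pB N) _; rewrite leq_add2r ltnW// win_growth1_mul.
- move=> i iB; split; first by apply: win_sub wab; lia.
  by move=> [_ /eqP]; rewrite eqn_modDr => /eqP.
move=> ij jB /win_eqP wij.
have /dvdnP[c cE] : j - i %| B`! by apply: dvdn_fact; lia.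
have [k kM] := runM (a + i); apply.
(* The period [j - i], iterated up to its multiple [B`!]. *)
have step d : d <= c -> x (a + i + k) = x (a + i + k + d * (j - i)).
  elim: d => [|d IH] dc; first by rewrite mul0n addn0.
  rewrite IH; last lia.
  have dcB : d.+1 * (j - i) <= B`! by rewrite cE leq_mul2r dc orbT.
  have := wij (k + d * (j - i)); rewrite /N => /(_ ltac:(lia)).
  by congr (x _ = x _); lia.
by rewrite cE; apply: step.
Qed.

(** By coprimality the residue of [l * c] mod [m] determines that of [c], so the
    windows at [l * c] split into [m] disjoint classes; each is a set of windows
    along a progression of step [l * m], of length [k] steps. *)
Lemma sync_lower (l m N k : nat) : 0 < l -> 0 < m -> coprime l m ->
  (forall a b, win x a N = win x b N -> a = b %[mod m]) -> N <= l * (m * k) ->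
  m * k.+1 <= nvals (fun c => win x (l * c) (l * (m * k))).
Proof.
move=> l0 m0 lm sync le; set h := fun c => _.
have hfin : finite_set (range h) := finite_win _ _ xt.
have [_ hsum] := nvals_residues m0 hfin.
apply: (@leq_trans (nvals (fun c => (h c, c %% m)))); last first.
  apply: (@nvals_le _ _ _ _ id hfin _).2 => a b hab; congr pair => //.
  have : l * a = l * b %[mod m].
    by apply: sync; move: hab => /(@win_sub _ _ _ _ 0 N); rewrite !addn0; apply.
  have dv c d : c <= d -> l * c = l * d %[mod m] -> c = d %[mod m].
    move=> cd /esym/eqP; rewrite eqn_mod_dvd ?leq_mul2l ?cd ?orbT// -mulnBr.
    by rewrite Gauss_dvdr 1?coprime_sym// -eqn_mod_dvd// => /eqP.
  by case: (leqP a b) => [|/ltnW] ab e; [exact: dv|apply/esym/dv].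
rewrite hsum; apply: (@leq_trans (\sum_(i < m) k.+1)).
  by rewrite sum_nat_const card_ord.
apply: leq_sum => i _.
have := @win_growth_mul (l * m) (l * i) k ltac:(by rewrite muln_gt0 l0).
congr (_ < nvals _); apply/funext => c; rewrite /h.
by congr win; rewrite ?mulnDr !mulnA.
Qed.

(** If the excess stayed below [m + l], both terms would have bounded excess,
    since each of them is at least [n + 1]; synchronisation then bounds both from
    below at the common value [n = l * m * k]. *)
Lemma excess_lower (l m : nat) : 0 < l -> 0 < m -> coprime l m ->
  exists n, 2 * n + (m + l) <=
    nvals (fun c => win x (l * c) (l * n)) + nvals (fun c => win x (m * c) (m * n)).
Proof.
move=> l0 m0 lm; apply: contrapT => H.
have gt q n : 0 < q -> n < nvals (fun c => win x (q * c) (q * n)).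
  by move=> /(win_growth_mul 0 n); under eq_fun do rewrite addn0.
have lt n : nvals (fun c => win x (l * c) (l * n))
    + nvals (fun c => win x (m * c) (m * n)) < 2 * n + (m + l).
  by rewrite ltnNge; apply/negP => le; apply: H; exists n.
have [|N1 s1] := @synchronisation l (m + l) l0.
  by move=> n; have := gt m n m0; have := lt n; lia.
have [|N2 s2] := @synchronisation m (m + l) m0.
  by move=> n; have := gt l n l0; have := lt n; lia.
(* Makes [l * (m * k)] exceed both synchronisation lengths. *)
pose k := N1 + N2.
have le q q' : 0 < q -> 0 < q' -> k <= q * (q' * (q * k)).
  move=> q0 q0'; rewrite !mulnA leq_pmull// !muln_gt0 q0 q0' //.
have L1 := @sync_lower l m N2 (l * k) l0 m0 lm s2 ltac:(have := le l m l0 m0; lia).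
have ml : coprime m l by rewrite coprime_sym.
have L2 := @sync_lower m l N1 (m * k) m0 l0 ml s1 ltac:(have := le m l m0 l0; lia).
have := lt (l * (m * k)); rewrite -{1}(mulnCA m l k).
by move: L1 L2; rewrite -(mulnCA m l k); lia.
Qed.

End Words.

(** * Padded words *)

(** Hermite's identity for the floor function. *)
Lemma sum_divn_shift (n m : nat) : 0 < m -> \sum_(i < m) (n + i) %/ m = n.
Proof.
move=> m0; elim: n => [|n IH].
  by rewrite big1// => i _; rewrite add0n divn_small.
have : \sum_(i < m.+1) (n + i) %/ m = n + (n %/ m).+1.
  by rewrite big_ord_recr/= IH divnDr// divnn m0 addn1.
rewrite big_ord_recl/= addn0.
under eq_bigr do rewrite /bump/= add1n addnS -addSn.
lia.
Qed.

(** Each letter is preceded by [L.-1] zeros, so that in base [t ^ L] the letter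
    itself is the digit. *)
Definition pad (L : nat) (y : nat -> nat) (k : nat) : nat :=
  if L %| k.+1 then y (k %/ L) else 0.

Lemma padE (L : nat) (y : nat -> nat) (c : nat) : 0 < L ->
  pad L y (L * c + L.-1) = y c.
Proof.
move=> L0; rewrite /pad -addnS prednK// -mulnSr dvdn_mulr//.
by rewrite mulnC divnMDl// divn_small ?addn0// prednK.
Qed.

Lemma pad_not_ev_periodic (L : nat) (y : nat -> nat) : 0 < L ->
  ~ ev_periodic y -> ~ ev_periodic (pad L y).
Proof.
move=> L0 ny [n [h [h0 per]]]; apply: ny; exists n, h; split=> // k nk.
have mul c i : n <= i -> pad L y (i + c * h) = pad L y i.
  move=> ni; elim: c => [|c IH]; first by rewrite addn0.
  by rewrite mulSnr addnA per//; lia.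
have nL : n <= L * k + L.-1.
  by rewrite (leq_trans nk)// (leq_trans (leq_pmull k L0)) ?leq_addr.
rewrite -(padE y k L0) -(mul L _ nL) -[LHS](padE y _ L0).
by congr pad; rewrite mulnDr addnAC.
Qed.

(** At the positions [l * c] with [c = i] mod [m], a window of length [l * n]
    meets only the [(n + i) %/ m] letters of a window of [y], and zeros. *)
Lemma pad_upper (l m n t : nat) (y : nat -> nat) : 0 < l -> 0 < m ->
  (forall k, y k < t) -> (forall e, nvals (win y ^~ e) <= e.+1) ->
  nvals (fun c => win (pad (l * m) y) (l * c) (l * n)) <= n + m.
Proof.
move=> l0 m0 yt yC; set x := pad _ _; set h := fun c => _.
have xt k : x k < t.
  by rewrite /x /pad; case: ifP => // _; exact: leq_ltn_trans (yt 0).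
have [hfin hsum] := nvals_residues m0 (finite_win _ _ xt : finite_set (range h)).
apply: (@leq_trans (nvals (fun c => (h c, c %% m)))).
  by apply: (@nvals_le _ _ _ _ id hfin _).2 => a b [].
rewrite hsum; apply: (@leq_trans (\sum_(i < m) ((n + i) %/ m + 1))); last first.
  by rewrite big_split/= sum_divn_shift// sum1_card card_ord.
apply: leq_sum => i _; rewrite addn1; apply: leq_trans (yC _).
apply: (@nvals_le _ _ _ _ id _ _).2; first exact: (finite_win _ id yt).
move=> a b /win_eqP e; apply/win_eqP => p pn.
have lm0 : 0 < l * m by rewrite muln_gt0 l0.
have posE c : l * (m * c + i) + p = l * m * c + (l * i + p).
  by rewrite mulnDr mulnA addnA.
have dvE c : (l * m %| (l * m * c + (l * i + p)).+1) = (l * m %| (l * i + p).+1).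
  by rewrite -addnS dvdn_addr // dvdn_mulr.
rewrite !posE /x /pad !dvE.
case: ifP => // dv; rewrite !(mulnC (l * m)) !divnMDl//; apply: e.
move: dv => /dvdnP[d dE]; rewrite leq_divRL//.
have := leq_trunc_div (l * i + p) (l * m); set Q := _ %/ _ => QE.
have Qd : Q < d by rewrite -(ltn_pmul2r lm0) -dE ltnS.
rewrite -(leq_pmul2l l0) mulnCA (leq_trans (leq_mul Qd (leqnn (l * m))))//.
by rewrite -dE [n + i]addnC mulnDr -addnS leq_add2l.
Qed.

(** * Words of complexity at most n + 1 *)

(** The sequences of prefix sums of the windows of length [e] form a chain for the
    pointwise order, so the total of their [e] excesses over [b] determines the
    window; this total lies between [0] and [e]. *)
Lemma balanced_complexity (y b : nat -> nat) (t : nat) :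
  (forall k, y k < t) ->
  (forall c i, b i <= \sum_(j < i) y (c + j) <= (b i).+1) ->
  (forall c c', (forall i, \sum_(j < i) y (c + j) <= \sum_(j < i) y (c' + j)) \/
                (forall i, \sum_(j < i) y (c' + j) <= \sum_(j < i) y (c + j))) ->
  forall e, nvals (win y ^~ e) <= e.+1.
Proof.
move=> yt yb chain e; pose F c i := \sum_(j < i) y (c + j).
pose s c := \sum_(i < e) (F c i.+1 - b i.+1).
have se c : s c < e.+1.
  rewrite ltnS (@leq_trans (\sum_(i < e) 1))//; last by rewrite sum1_card card_ord.
  by apply: leq_sum => i _; have := yb c i.+1; rewrite /F; lia.
have sfin : finite_set (range s).
  by apply: (@sub_finite_set _ _ `I_e.+1) => // _ [c _ <-]; exact: se.
have Feq c c' : (forall i, F c i <= F c' i) -> s c = s c' ->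
    forall i, i < e -> F c i.+1 = F c' i.+1.
  move=> le sE i ie; apply/eqP; rewrite eqn_leq le/= leqNgt; apply/negP => lt.
  suff : s c < s c' by rewrite sE ltnn.
  rewrite /s (bigD1 (Ordinal ie))//= [X in _ < X](bigD1 (Ordinal ie))//=.
  rewrite -addSn; apply: leq_add; last by apply: leq_sum => j _; exact: leq_sub2r.
  by have := yb c i.+1; move: lt; rewrite /F; lia.
apply: (@leq_trans (nvals s)); last first.
  have : size (fset_set (range s)) <= size (iota 0 e.+1); last by rewrite size_iota.
  apply: uniq_leq_size; first exact: fset_uniq.
  by move=> w /(mem_vals _ sfin)[c <-]; rewrite mem_iota add0n se.
apply: (@nvals_le _ _ _ _ id sfin _).2 => c c' sE.
have {}Feq i : i < e -> F c i.+1 = F c' i.+1.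
  by case: (chain c c') => le ie; [exact: Feq|apply/esym/Feq].
have F0 d : F d 0 = 0 by rewrite /F big_ord0.
have FS d i : F d i.+1 = F d i + y (d + i) by rewrite /F big_ord_recr.
apply/win_eqP => -[|i] ie; have := Feq _ ie; rewrite !FS; first by rewrite !F0.
by rewrite -!FS (FS _ i.+1) (FS c' i.+1) (Feq i (ltnW ie)) => /addnI.
Qed.

(** * Numeration in powers of a base *)

(** The integer whose base [b] digits are the first [n] letters of [a]. *)
Fixpoint pref (b : nat) (a : nat -> nat) (n : nat) : nat :=
  if n is n'.+1 then b * pref b a n' + a n' else 0.

Lemma pref_lt (b : nat) (a : nat -> nat) (n : nat) :
  (forall k, a k < b) -> pref b a n < b ^ n.
Proof.
move=> ab; elim: n => [//|n IH] /=; rewrite expnS.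
apply: (@leq_trans (b * (pref b a n).+1)); last by rewrite leq_mul2l IH orbT.
by rewrite mulnS addnC -addSn leq_add2r.
Qed.

Lemma prefD (b : nat) (a : nat -> nat) (n k : nat) :
  pref b a (n + k) = b ^ k * pref b a n + pref b (fun i => a (n + i)) k.
Proof.
elim: k => [|k IH]; first by rewrite addn0 mul1n addn0.
by rewrite addnS /= IH mulnDr mulnA -expnS addnA.
Qed.

Lemma pref_ext (b : nat) (a a' : nat -> nat) (n : nat) :
  (forall i, i < n -> a i = a' i) -> pref b a n = pref b a' n.
Proof.
elim: n => [//|n IH] e /=; rewrite e// IH// => i /ltnW; exact: e.
Qed.

Lemma pref_inj (b : nat) (a a' : nat -> nat) (n : nat) :
  (forall k, a k < b) -> (forall k, a' k < b) ->
  pref b a n = pref b a' n -> forall i, i < n -> a i = a' i.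
Proof.
move=> ab a'b; elim: n => [//|n IH] /= e i.
have b0 : 0 < b by exact: leq_ltn_trans (ab 0).
have [e1 e2] : pref b a n = pref b a' n /\ a n = a' n.
  split; [have := congr1 (divn ^~ b) e|have := congr1 (modn ^~ b) e].
    by rewrite /= ![b * _]mulnC !divnMDl// !divn_small// !addn0.
  by rewrite /= ![b * _]mulnC !modnMDl !modn_small.
by rewrite ltnS leq_eqVlt => /orP[/eqP->//|]; exact: IH.
Qed.

Definition chunk (t l : nat) (x : nat -> nat) (k : nat) : nat :=
  pref t (fun i => x (l * k + i)) l.

Lemma chunk_lt (t l : nat) (x : nat -> nat) (k : nat) :
  (forall k, x k < t) -> chunk t l x k < t ^ l.
Proof. by move=> xt; apply: pref_lt. Qed.

Lemma pref_chunk (t l : nat) (x : nat -> nat) (n : nat) :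
  pref (t ^ l) (chunk t l x) n = pref t x (l * n).
Proof.
elim: n => [|n IH]; first by rewrite muln0.
by rewrite /= IH mulnSr prefD.
Qed.

Lemma chunk_complexity (t l : nat) (x : nat -> nat) (n : nat) : 0 < l ->
  (forall k, x k < t) ->
  nvals (win (chunk t l x) ^~ n) = nvals (fun c => win x (l * c) (l * n)).
Proof.
move=> l0 xt; have ct k : chunk t l x k < t ^ l := chunk_lt l k xt.
apply/eqP; rewrite eqn_leq; apply/andP; split.
  apply: (@nvals_le _ _ _ _ id (finite_win _ _ xt) _).2 => c c' /win_eqP e.
  apply/win_eqP => i i_n; apply: pref_ext => j jl.
  rewrite !mulnDr -!addnA; apply: e.
  apply: (@leq_trans (l * i.+1)); last by rewrite leq_mul2l i_n orbT.
  by rewrite mulnSr ltn_add2l.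
apply: (@nvals_le _ _ _ _ id (finite_win _ id ct) _).2 => c c' /win_eqP e.
apply/win_eqP => i i_n.
have ql : i %/ l < n by rewrite ltn_divLR// mulnC.
have := @pref_inj t _ _ l (fun=> xt _) (fun=> xt _) (e _ ql) (i %% l) (ltn_pmod i l0).
by rewrite !mulnDr -!addnA ![l * (i %/ l)]mulnC -divn_eq.
Qed.

(** With [a * l = b * m + 1], the root is [r ^ a / s ^ b]; it is an integer
    because the [l]-th powers of its terms divide each other. *)
Lemma common_root (r s m l : nat) : 0 < r -> 0 < s -> 0 < m -> 0 < l ->
  r ^ m = s ^ l ->
  (forall m' l', 0 < m' -> 0 < l' -> r ^ m' = s ^ l' -> m <= m' /\ l <= l') ->
  coprime l m /\ exists t, r = t ^ l /\ s = t ^ m.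
Proof.
move=> r0 s0 m0 l0 rs min.
have lm : coprime l m.
  have d0 : 0 < gcdn l m by rewrite gcdn_gt0 l0.
  have /dvdnP[l' lE] := dvdn_gcdl l m; have /dvdnP[m' mE] := dvdn_gcdr l m.
  have l'0 : 0 < l' by case: (l') lE l0 => // ->.
  have m'0 : 0 < m' by case: (m') mE m0 => // ->.
  have [|+ _] := min m' l' m'0 l'0.
    apply/eqP; rewrite -(eqn_exp2r _ _ d0) -!expnM.
    by rewrite -mE -lE rs.
  rewrite {1}mE -{2}[m']muln1 leq_pmul2l// /coprime => d1.
  by rewrite eqn_leq d1.
split=> //; case: (egcdnP m l0) => a b ab _.
rewrite (eqP lm) in ab.
have dv : s ^ b %| r ^ a.
  rewrite -(dvdn_pexp2r _ _ l0) -!expnM ab [b * l]mulnC [b * m]mulnC.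
  by rewrite expnD [s ^ _]expnM -rs -expnM dvdn_mulr.
have [t tE] := dvdnP dv; exists t; split; apply/eqP.
- have sb0 : 0 < s ^ (b * l) by rewrite expn_gt0 s0.
  rewrite -(eqn_pmul2r sb0) [s ^ (b * l)]expnM -expnMn -tE -(expnM r) ab.
  by rewrite -expnM [b * l]mulnC [s ^ (l * b)]expnM -rs -expnM addn1 expnS [b * m]mulnC.
- have sb0 : 0 < s ^ (b * m) by rewrite expn_gt0 s0.
  rewrite -(eqn_pmul2r sb0) [s ^ (b * m)]expnM -expnMn -tE -(expnM r).
  by rewrite [a * m]mulnC [r ^ (m * a)]expnM rs -!expnM [l * a]mulnC ab addn1 expnS.
Qed.

Local Open Scope ring_scope.

(** * Expansions of real numbers *)

Lemma small_power_eq0 (R : realType) (b : nat) (d : R) : (1 < b)%N ->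
  (forall k, `|d| * b%:R ^+ k <= 1) -> d = 0.
Proof.
move=> b1 H; apply/eqP/contraT => d0.
have d_gt0 : 0 < `|d| by rewrite normr_gt0.
have := archi_boundP (ltW (divr_gt0 ltr01 d_gt0)); set k := Num.bound _ => Hk.
have kb : (k <= b ^ k)%N by apply: ltnW; exact: ltn_expl.
have := H k; rewrite leNgt -natrX => /negP[].
rewrite mulrC -ltr_pdivrMr//; apply: lt_le_trans Hk _.
by rewrite ler_nat.
Qed.

(** The prefixes of the expansion of [z] in base [b] are the integer parts of
    [z * b ^ n].  In this form the expansion is visibly unique, and passing from
    base [t] to base [t ^ l] just restricts [n] to the multiples of [l]. *)
Definition floor_digits (R : realType) (b : nat) (z : R) (a : nat -> nat) : Prop :=
  forall n, (pref b a n)%:R <= z * b%:R ^+ n < (pref b a n).+1%:R.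

Section Digits.
Context {R : realType}.
Variables (b : nat).
Hypothesis (b1 : (1 < b)%N).

Let B_gt0 n : 0 < (b%:R : R) ^+ n.
Proof. by rewrite exprn_gt0// ltr0n ltnW. Qed.

Lemma series_pref (a : nat -> nat) (n : nat) :
  series (fun k => (a k)%:R / b%:R ^+ k.+1 : R) n = (pref b a n)%:R / b%:R ^+ n.
Proof.
rewrite /series/=; elim: n => [|n IH]; first by rewrite big_geq// mul0r.
rewrite big_nat_recr//= IH natrD natrM mulrDl exprS; congr (_ + _).
by rewrite invfM mulrACA mulfV ?mul1r// pnatr_eq0; case: (b) b1.
Qed.

Lemma pref_bounds (a : nat -> nat) (n k : nat) : (forall k, a k < b)%N ->
  (b ^ k * pref b a n <= pref b a (n + k) < b ^ k * (pref b a n).+1)%N.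
Proof.
move=> ab; rewrite prefD leq_addr/= mulnSr ltn_add2l.
by apply: pref_lt => i; exact: ab.
Qed.

(** The tail after [n] digits is at most [b ^- n], and strictly less because some
    later digit is not [b.-1]. *)
Lemma floor_digits_of_series (z : R) (a : nat -> nat) :
  (forall k, a k < b)%N -> infinite_set [set k | a k <> b.-1] ->
  series (fun k => (a k)%:R / b%:R ^+ k.+1 : R) @ \oo --> z ->
  floor_digits b z a.
Proof.
move=> ab inf cv n.
have lo n' : (pref b a n')%:R <= z * b%:R ^+ n'.
  rewrite -ler_pdivrMr//; apply: (cvgr_to_ge cv).
  exists n' => // N /= /subnKC <-; move: (N - n')%N => k; rewrite series_pref.
  rewrite ler_pdivrMr// mulrAC ler_pdivlMr// exprD mulrCA mulrC ler_pM2r//.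
  rewrite -natrX -natrM ler_nat mulnC.
  by have /andP[] := pref_bounds n' k ab.
have hi n' : z * b%:R ^+ n' <= (pref b a n').+1%:R.
  rewrite -ler_pdivlMr//; apply: (cvgr_to_le cv).
  exists n' => // N /= /subnKC <-; move: (N - n')%N => k; rewrite series_pref.
  rewrite ler_pdivrMr// mulrAC ler_pdivlMr// exprD mulrCA [leRHS]mulrC ler_pM2r//.
  rewrite -natrX -natrM ler_nat mulnC.
  by have /andP[_ /ltnW] := pref_bounds n' k ab.
rewrite lo/=.
have [k nk ak] : exists2 k, (n <= k)%N & a k <> b.-1.
  apply: contrapT => H; apply: inf.
  apply: (@sub_finite_set _ _ `I_n) => // k /= ak.
  by rewrite ltnNge; apply/negP => nk; apply: H; exists k.
have lt : z * b%:R ^+ k < (pref b a k).+1%:R.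
  have b0 : 0 < (b%:R : R) by rewrite ltr0n ltnW.
  rewrite -(ltr_pM2l b0) mulrCA -exprS; apply: le_lt_trans (hi _) _.
  rewrite -natrM ltr_nat /= mulnS; have := ab k; lia.
rewrite -(subnKC nk) exprD mulrA in lt.
rewrite -(ltr_pM2r (B_gt0 (k - n))); apply: lt_le_trans lt _.
rewrite -natrX -natrM ler_nat mulnC.
by have /andP[] := pref_bounds n (k - n) ab.
Qed.

(** If all digits from [n] on were [b.-1], the distance from [z * b ^ n] to the
    integer above would stay at most [1] after multiplication by any [b ^ k],
    though it is positive. *)
Lemma series_of_floor_digits (z : R) (a : nat -> nat) :
  floor_digits b z a -> infinite_set [set k | a k <> b.-1] /\
  series (fun k => (a k)%:R / b%:R ^+ k.+1 : R) @ \oo --> z.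
Proof.
move=> za; split.
  move=> fin.
  have [n nk'] := finite_nat_bounded fin.
  have nk k : (n <= k)%N -> a k = b.-1 by move=> /nk' /contrapT.
  have pE k : (pref b a (n + k)).+1 = (b ^ k * (pref b a n).+1)%N.
    elim: k => [|k IH]; first by rewrite addn0 mul1n.
    rewrite addnS /= nk ?leq_addr// expnS -mulnA -IH mulnS; move: b1; lia.
  have /andP[_] := za n; rewrite -subr_gt0 => d0.
  suff d00 : (pref b a n).+1%:R - z * b%:R ^+ n = 0 by rewrite d00 ltxx in d0.
  apply: (small_power_eq0 b1) => k.
  rewrite gtr0_norm// mulrBl -mulrA -exprD -natrX -natrM mulnC -pE.
  by rewrite lerBlDr -addn1 natrD addrC lerD2l; have /andP[] := za (n + k)%N.
have b_inv : `|(b%:R : R)^-1| < 1.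
  by rewrite ger0_norm ?invr_ge0// invf_lt1 ?ltr1n// ltr0n ltnW.
apply: (@squeeze_cvgr _ _ _ _ (fun n => z - b%:R^-1 ^+ n) (cst z)).
- apply: nearW => n /=; rewrite series_pref exprVn.
  have /andP[lo /ltW hi] := za n.
  rewrite ler_pdivrMr// lo andbT ler_pdivlMr// mulrBl mulVf ?gt_eqF//.
  by rewrite lerBlDr -[1]/(1%:R) -natrD addn1.
- rewrite -[X in _ --> X]subr0; apply: cvgB; first exact: cvg_cst.
  exact: cvg_expr.
- exact: cvg_cst.
Qed.

Lemma floor_digits_uniq (z : R) (a a' : nat -> nat) :
  (forall k, a k < b)%N -> (forall k, a' k < b)%N ->
  floor_digits b z a -> floor_digits b z a' -> a = a'.
Proof.
move=> ab a'b za za'; apply/funext => k.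
apply: (@pref_inj b a a' k.+1) => //.
by rewrite -(truncn_def (za k.+1)) -(truncn_def (za' k.+1)).
Qed.

Lemma floor_digits_exists (z : R) : 0 <= z < 1 ->
  exists2 a, (forall k, a k < b)%N & floor_digits b z a.
Proof.
move=> /andP[z0 z1]; pose T n := Num.truncn (z * b%:R ^+ n).
have T0 n : 0 <= z * b%:R ^+ n by rewrite mulr_ge0// ltW.
have TS n : (b * T n <= T n.+1 < b * (T n).+1)%N.
  have b0 : 0 < (b%:R : R) by rewrite ltr0n ltnW.
  have /andP[lo hi] := truncn_itv (T0 n).
  rewrite /T truncn_ge_nat// truncn_lt_nat// exprS mulrCA !natrM.
  by rewrite ler_pM2l// ltr_pM2l// lo hi.
exists (fun n => T n.+1 - b * T n)%N.
  by move=> k; have := TS k; rewrite mulnS; lia.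
suff pE n : pref b (fun n => T n.+1 - b * T n)%N n = T n.
  by move=> n; rewrite pE; exact: truncn_itv.
elim: n => [|n /= ->]; last by have := TS n; lia.
by apply/esym/truncn_def; rewrite expr0 mulr1 z0.
Qed.

Lemma expansion_exists (xi : R) : exists a, is_expansion b xi a.
Proof.
have [|a ab za] := @floor_digits_exists (xi - (Num.floor xi)%:~R).
  by rewrite subr_ge0 floor_le/= ltrBlDl -[1]/(1%:~R) -intrD floorD1_gt.
by exists a; have [] := series_of_floor_digits za.
Qed.

Lemma is_expansion_floor (xi : R) (a : nat -> nat) :
  is_expansion b xi a -> floor_digits b (xi - (Num.floor xi)%:~R) a.
Proof. by move=> [ab inf cv]; exact: floor_digits_of_series. Qed.

Lemma expansion_eq (xi : R) (a : nat -> nat) :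
  is_expansion b xi a -> expansion b xi = a.
Proof.
move=> ax; apply: floor_digits_uniq; try exact: is_expansion_floor ax.
- by rewrite /expansion; case: xgetP => [c -> []//|/(_ a)].
- by case: ax.
- by rewrite /expansion; case: xgetP => [c -> /is_expansion_floor//|/(_ a)].
Qed.

End Digits.

Lemma expansion_chunk (R : realType) (t l : nat) (xi : R) (x : nat -> nat) :
  (1 < t)%N -> (0 < l)%N -> is_expansion t xi x ->
  expansion (t ^ l) xi = chunk t l x.
Proof.
move=> t1 l0 xx; have [xt _ _] := xx.
have tl1 : (1 < t ^ l)%N by rewrite -(exp1n l) ltn_exp2r.
have za : floor_digits (t ^ l) (xi - (Num.floor xi)%:~R) (chunk t l x).
  move=> n; rewrite pref_chunk natrX -exprM.
  exact: (is_expansion_floor t1 xx).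
apply: expansion_eq => //.
by split=> [k||]; [exact: chunk_lt|apply: (series_of_floor_digits tl1 za).1
  |apply: (series_of_floor_digits tl1 za).2].
Qed.

Lemma blocks_range (a : nat -> nat) (n : nat) : blocks a n = range (win a ^~ n).
Proof.
by apply/seteqP; split=> [w [j ->]|w [j _ <-]]; [exists j|exists j].
Qed.

Lemma complexity_chunk (R : realType) (t l n : nat) (xi : R) (x : nat -> nat) :
  (1 < t)%N -> (0 < l)%N -> is_expansion t xi x ->
  complexity n xi (t ^ l) = nvals (fun c => win x (l * c) (l * n)).
Proof.
move=> t1 l0 xx; rewrite /complexity (expansion_chunk t1 l0 xx) blocks_range.
by apply: chunk_complexity => //; case: xx.
Qed.

(** For a word of period [h] after [n], the integers
    [pref (n + k + h) - pref (n + k)] form a geometric progression of ratio [b]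
    which stays close to [z * (b ^ h - 1) * b ^ (n + k)]; so the two agree. *)
Lemma irrational_not_ev_periodic (R : realType) (b : nat) (xi : R)
    (a : nat -> nat) : (1 < b)%N -> is_expansion b xi a -> irrational xi ->
  ~ ev_periodic a.
Proof.
move=> b1 xa ir [n [h [h0 per]]]; apply: ir.
have za := is_expansion_floor b1 xa; set z := xi - _ in za.
have zE : z = xi - (Num.floor xi)%:~R by []; clearbody z.
pose D k : R := (pref b a (n + k + h))%:R - (pref b a (n + k))%:R.
have DE k : D k = b%:R ^+ k * D 0%N.
  elim: k => [|k IH]; first by rewrite mul1r.
  rewrite exprS -mulrA -IH /D addnS addSn /= per ?leq_addr//.
  by rewrite !natrD !natrM opprD addrACA subrr addr0 -mulrBr.
have d0 : z * (b%:R ^+ (n + h) - b%:R ^+ n) - D 0%N = 0.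
  apply: (small_power_eq0 b1) => k.
  rewrite -[b%:R ^+ k]ger0_norm ?exprn_ge0// -normrM mulrBl [D 0%N * _]mulrC -DE.
  have /andP[l1 u1] := za (n + k)%N; have /andP[l2 u2] := za (n + k + h)%N.
  rewrite -mulrA mulrBl -!exprD -addnA [(h + k)%N]addnC addnA mulrBr /D.
  rewrite -!natr1 in u1 u2.
  by rewrite ler_norml; apply/andP; split; lra.
have bn : (b%:R ^+ (n + h) - b%:R ^+ n : R) = (b ^ (n + h) - b ^ n)%N%:R.
  by rewrite natrB ?natrX// leq_exp2l// leq_addr.
have bn0 : ((b ^ (n + h) - b ^ n)%N%:R : R) != 0.
  by rewrite pnatr_eq0 subn_eq0 -ltnNge ltn_exp2l// -[ltnLHS]addn0 ltn_add2l.
rewrite bn in d0; apply/rationalP.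
exists ((pref b a (n + h))%:Z - (pref b a n)%:Z
  + Num.floor xi * (b ^ (n + h) - b ^ n)%N%:Z).
exists (b ^ (n + h) - b ^ n)%N.
apply: (mulIf bn0); rewrite divfK// intrD intrB intrM -!pmulrn.
move: d0; rewrite zE /D !addn0 mulrBl; lra.
Qed.

(** * The limit of the excess *)

Section Limit.
Context {R : realType}.
Variables (t l m : nat) (xi : R) (x : nat -> nat).
Hypotheses (t1 : (1 < t)%N) (l0 : (0 < l)%N) (m0 : (0 < m)%N).
Hypotheses (lm : coprime l m) (xx : is_expansion t xi x) (nx : ~ ev_periodic x).

Let xt k : (x k < t)%N. Proof. by case: xx. Qed.

Let u := complexity_excess (t ^ l) (t ^ m) xi.

Lemma complexity_excess_ge (n c : nat) :
  ((c%:R)%:E <= u n)%E =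
  (2 * n + c <= complexity n xi (t ^ l) + complexity n xi (t ^ m))%N.
Proof.
by rewrite /u /complexity_excess lee_fin lerBrDl -!natrD ler_nat.
Qed.

Lemma complexity_excess_le (n c : nat) :
  (u n <= (c%:R)%:E)%E =
  (complexity n xi (t ^ l) + complexity n xi (t ^ m) <= 2 * n + c)%N.
Proof.
by rewrite /u /complexity_excess lee_fin lerBlDl -!natrD ler_nat.
Qed.

Lemma complexity_growth (q n : nat) : (0 < q)%N ->
  (complexity n xi (t ^ q) < complexity n.+1 xi (t ^ q))%N.
Proof.
move=> q0; rewrite !(complexity_chunk _ t1 q0 xx).
have := win_growth xt nx 0 (q * n) q0; rewrite -mulnSr.
by under eq_fun do rewrite addn0; under [in X in (_ < X)%N]eq_fun do rewrite addn0.
Qed.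

Lemma complexity_excess_cvg : u @ \oo --> ereal_sup (range u).
Proof.
apply: ereal_nondecreasing_cvgn; apply/nondecreasing_seqP => n.
rewrite /u /complexity_excess lee_fin mulnS natrD.
have := complexity_growth n l0; have := complexity_growth n m0.
by rewrite -!(ler_nat R) -!natr1; lra.
Qed.

Lemma complexity_excess_sup_ge : (((m + l)%N%:R)%:E <= ereal_sup (range u))%E.
Proof.
have [n le] := excess_lower xt nx l0 m0 lm.
apply: (@le_trans _ _ (u n)); last by apply: ereal_sup_ubound; exists n.
rewrite complexity_excess_ge (complexity_chunk _ t1 l0 xx).
by rewrite (complexity_chunk _ t1 m0 xx).
Qed.

End Limit.

(** * Sturmian words *)

(** The mechanical word of slope [al] and intercept [0], for [0 < al < 1]. *)
Definition sturm (R : realType) (al : R) (k : nat) : nat :=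
  (Num.truncn (k.+1%:R * al) - Num.truncn (k%:R * al))%N.

Section Sturmian.
Context {R : realType}.
Variable al : R.
Hypothesis al01 : 0 < al < 1.

Let T (k : nat) : nat := Num.truncn (k%:R * al).

Let al0 : 0 <= al. Proof. by case/andP: al01 => /ltW. Qed.

Let Titv k : (T k)%:R <= k%:R * al < (T k).+1%:R.
Proof. by apply: truncn_itv; rewrite mulr_ge0. Qed.

Lemma sum_sturm (c i : nat) : (T (c + i) = T c + \sum_(j < i) sturm al (c + j))%N.
Proof.
elim: i => [|i IH]; first by rewrite big_ord0 !addn0.
rewrite big_ord_recr/= addnA -IH /sturm addnS -/(T _) -/(T _) subnKC//.
by apply: le_truncn; rewrite ler_wpM2r// ler_nat.
Qed.

Lemma sturm_le1 (k : nat) : (sturm al k < 2)%N.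
Proof.
have := sum_sturm k 1; rewrite big_ord1 !addn0 addn1 => TE.
have /andP[_ hi] := Titv k; have /andP[lo _] := Titv k.+1.
have /andP[_ a1] := al01.
have : ((T k.+1)%:R < (T k).+2%:R :> R) by rewrite -!natr1 in lo hi *; lra.
by rewrite ltr_nat TE; lia.
Qed.

(** The number of ones in the window of length [i] at [c] is the integer part of
    [{c * al} + i * al], where [{c * al}] is the fractional part: it is monotone
    in [{c * al}], and differs from that of [i * al] by at most one. *)
Lemma sturm_complexity (e : nat) : (nvals (win (sturm al) ^~ e) <= e.+1)%N.
Proof.
apply: (@balanced_complexity _ T 2); first exact: sturm_le1.
- move=> c i; have TE := sum_sturm c i; set S := (\sum_(j < i) _)%N in TE *.
  have /andP[l1 u1] := Titv c; have /andP[l2 u2] := Titv i.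
  have /andP[l3 u3] := Titv (c + i)%N.
  rewrite TE !natrD mulrDl in l3; rewrite TE -natr1 !natrD mulrDl in u3.
  rewrite -!natr1 in u1 u2.
  by apply/andP; split; rewrite -ltnS -(ltr_nat R) -!natr1; lra.
- have le c c' : c%:R * al - (T c)%:R <= c'%:R * al - (T c')%:R -> forall i,
      (\sum_(j < i) sturm al (c + j) <= \sum_(j < i) sturm al (c' + j))%N.
    move=> cc i; have TE := sum_sturm c i; have TE' := sum_sturm c' i.
    set S := (\sum_(j < i) _)%N in TE *; set S' := (\sum_(j < i) _)%N in TE' *.
    have /andP[l1 u1] := Titv (c + i)%N; have /andP[l2 u2] := Titv (c' + i)%N.
    rewrite TE !natrD mulrDl in l1; rewrite TE -natr1 !natrD mulrDl in u1.
    rewrite TE' !natrD mulrDl in l2; rewrite TE' -natr1 !natrD mulrDl in u2.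
    by rewrite -ltnS -(ltr_nat R) -!natr1; lra.
  move=> c c'.
  have [cc|/ltW cc] := lerP (c%:R * al - (T c)%:R) (c'%:R * al - (T c')%:R).
    by left; exact: le.
  by right; exact: le.
Qed.

(** With [D] ones in a period of length [h], the slope is [D / h]. *)
Lemma sturm_not_ev_periodic : irrational al -> ~ ev_periodic (sturm al).
Proof.
move=> ir [n [h [h0 per]]]; apply: ir.
pose D := (\sum_(j < h) sturm al (n + j))%N.
have perm i : forall k, (n <= k)%N -> sturm al (k + i * h) = sturm al k.
  elim: i => [|i IH] k nk; first by rewrite addn0.
  by rewrite mulSnr addnA per ?IH//; lia.
have TD i : T (n + i * h) = (T n + i * D)%N.
  elim: i => [|i IH]; first by rewrite !addn0.
  rewrite mulSnr addnA sum_sturm IH mulSnr addnA; congr (_ + _)%N.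
  by apply: eq_bigr => j _; rewrite addnAC perm// leq_addr.
suff e : D%:R - h%:R * al = 0.
  apply/rationalP; exists D%:Z, h.
  have h0' : (h%:R : R) != 0 by rewrite pnatr_eq0 -lt0n.
  by apply: (mulIf h0'); rewrite divfK// -pmulrn; lra.
apply: (@small_power_eq0 _ 2) => // k.
rewrite -[2%:R ^+ k]ger0_norm ?exprn_ge0// -normrM -natrX.
have /andP[l1 u1] := Titv n; have /andP[l2 u2] := Titv (n + 2 ^ k * h)%N.
rewrite TD !natrD !natrM mulrDl in l2; rewrite TD -natr1 !natrD !natrM mulrDl in u2.
rewrite -!natr1 in u1.
rewrite ler_norml; apply/andP; split; nra.
Qed.

End Sturmian.

(** The slope is the limit frequency of ones. *)
Lemma sturm_inj (R : realType) (al be : R) : 0 < al < 1 -> 0 < be < 1 ->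
  sturm al = sturm be -> al = be.
Proof.
move=> a01 b01 e; apply/eqP; rewrite -subr_eq0; apply/eqP.
apply: (@small_power_eq0 _ 2) => // k.
rewrite -[2%:R ^+ k]ger0_norm ?exprn_ge0// -normrM -natrX.
have E := sum_sturm a01 0 (2 ^ k); have E' := sum_sturm b01 0 (2 ^ k).
rewrite -e in E'; rewrite !mul0r truncn0 !add0n in E E'.
have la : 0 <= (2 ^ k)%:R * al by rewrite mulr_ge0//; case/andP: a01 => /ltW.
have lb : 0 <= (2 ^ k)%:R * be by rewrite mulr_ge0//; case/andP: b01 => /ltW.
have /andP[] := truncn_itv la; have /andP[] := truncn_itv lb.
rewrite E E' -!natr1 => l1 u1 l2 u2.
by rewrite ler_norml; apply/andP; split; lra.
Qed.

(** * Uncountably many extremal numbers *)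

Lemma expansion_of_word (R : realType) (b : nat) (a : nat -> nat) : (1 < b)%N ->
  (forall k, a k < b)%N -> ~ ev_periodic a -> exists xi : R, is_expansion b xi a.
Proof.
move=> b1 ab na; pose S := series (fun k => (a k)%:R / b%:R ^+ k.+1 : R).
have B0 n : 0 < (b%:R : R) ^+ n by rewrite exprn_gt0// ltr0n ltnW.
have cv : cvgn S.
  apply: nondecreasing_is_cvgn.
    apply/nondecreasing_seqP => n; rewrite /S -subr_ge0 seriesSB.
    by rewrite divr_ge0// ltW.
  exists 1 => _ [n _ <-]; rewrite /S series_pref// ler_pdivrMr// mul1r -natrX.
  by rewrite ler_nat ltnW// pref_lt.
have inf : infinite_set [set k | a k <> b.-1].
  move=> fin; apply: na.
  have [n nk] := finite_nat_bounded fin.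
  have aE i : (n <= i)%N -> a i = b.-1 by move=> /nk /contrapT.
  by exists n, 1%N; split=> // k le; rewrite !aE// (leq_trans le) ?leq_addr.
have /andP[] := floor_digits_of_series b1 ab inf cv 0.
rewrite /= expr0 mulr1 => lo hi.
exists (limn S); split=> //.
have -> : Num.floor (limn S) = 0 by apply: floor_def; rewrite lo.
by rewrite subr0.
Qed.

(** Countable sets have measure zero, and ]0, 1[ has measure one. *)
Lemma uncountable_irrational01 (R : realType) :
  ~ countable [set al : R | 0 < al < 1 /\ irrational al].
Proof.
move=> c1.
have c2 : countable (@rational R).
  by apply: sub_countable (card_image_le _ _) _.
have m1 := countable_lebesgue_measure0 c1.
have m2 := countable_lebesgue_measure0 c2.
have : countable (`]0, 1[%classic : set R).
  pose F (i : bool) :=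
    if i then [set al : R | 0 < al < 1 /\ irrational al] else @rational R.
  apply: (@sub_countable _ _ _ (\bigcup_(i in [set: bool]) F i)).
    apply: subset_card_le => al /=; rewrite in_itv/= => a01.
    have [r|ir] := pselect (rational al); first by exists false.
    by exists true => //; split.
  by apply: bigcup_countable => // -[].
move=> /countable_lebesgue_measure0; rewrite lebesgue_measure_itv/= lte_fin ltr01.
by rewrite oppr0 adde0 => /eqP; rewrite onee_eq0.
Qed.

Theorem theorem1p4 (R : realType) (r s m l : nat)
  (hr : (2 <= r)%N) (hs : (2 <= s)%N)
  (hdep : mult_dependent r s)
  (hm : (0 < m)%N) (hl : (0 < l)%N)
  (hml : (r ^ m = s ^ l)%N)
  (hmin : forall m' l' : nat, (0 < m')%N -> (0 < l')%N ->
     (r ^ m' = s ^ l')%N -> (m <= m')%N /\ (l <= l')%N) :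
  ~ countable [set xi : R |
      complexity_excess r s xi @ \oo --> ((m + l)%N%:R%:E : \bar R)] /\
  (forall xi : R, irrational xi ->
     exists2 L : \bar R,
       complexity_excess r s xi @ \oo --> L & ((m + l)%N%:R%:E <= L)%E).
Proof.
have [lm [t [rE sE]]] := common_root (ltnW hr) (ltnW hs) hm hl hml hmin.
have t1 : (1 < t)%N.
  rewrite ltnNge; apply/negP => t1; move: hr.
  by rewrite rE ltnNge -{1}(exp1n l) leq_exp2r// t1.
rewrite rE sE; split; last first.
  move=> xi ir; have [x xx] := expansion_exists t1 xi.
  have nx := irrational_not_ev_periodic t1 xx ir.
  exists (ereal_sup (range (complexity_excess (t ^ l) (t ^ m) xi))).
    exact: complexity_excess_cvg t1 hl hm xx nx.
  exact: complexity_excess_sup_ge t1 hl hm lm xx nx.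
set S := [set _ | _] => cS; apply: (@uncountable_irrational01 R).
set I := [set _ | _].
have lm0 : (0 < l * m)%N by rewrite muln_gt0 hl.
have wordE al : I al -> exists xi : R, is_expansion t xi (pad (l * m) (sturm al)).
  move=> [a01 ir]; apply: expansion_of_word => //.
    move=> k; rewrite /pad; case: ifP => _; last exact: ltnW.
    exact: leq_trans (sturm_le1 a01 _) t1.
  by apply: pad_not_ev_periodic => //; exact: sturm_not_ev_periodic.
pose g (al : R) : R := xget 0 [set xi | is_expansion t xi (pad (l * m) (sturm al))].
have gE al : I al -> is_expansion t (g al) (pad (l * m) (sturm al)).
  by move=> /wordE[xi xiE]; rewrite /g; case: xgetP => [? -> //|/(_ xi)].
have gS al : I al -> S (g al).
  move=> Ial; have gal := gE _ Ial; have [a01 ir] := Ial.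
  have nx : ~ ev_periodic (pad (l * m) (sturm al)).
    by apply: pad_not_ev_periodic => //; exact: sturm_not_ev_periodic.
  rewrite /S/=.
  suff <- : ereal_sup (range (complexity_excess (t ^ l) (t ^ m) (g al)))
      = ((m + l)%N%:R)%:E.
    exact: complexity_excess_cvg t1 hl hm gal nx.
  apply/eqP; rewrite eq_le (complexity_excess_sup_ge t1 hl hm lm gal nx) andbT.
  apply: ge_ereal_sup => _ [n _ <-]; rewrite complexity_excess_le.
  rewrite (complexity_chunk _ t1 hl gal) (complexity_chunk _ t1 hm gal).
  have Cl := pad_upper n hl hm (sturm_le1 a01) (sturm_complexity a01).
  have := pad_upper n hm hl (sturm_le1 a01) (sturm_complexity a01).
  by rewrite [(m * l)%N]mulnC; lia.
have ginj : {in I &, injective g}.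
  move=> al be /set_mem Ial /set_mem Ibe gab.
  have pE : pad (l * m) (sturm al) = pad (l * m) (sturm be).
    by rewrite -(expansion_eq t1 (gE _ Ial)) -(expansion_eq t1 (gE _ Ibe)) gab.
  apply: sturm_inj; [by case: Ial|by case: Ibe|].
  by apply/funext => k; rewrite -(padE _ k lm0) pE padE.
rewrite -(eq_countable (inj_card_eq ginj)).
apply: sub_countable cS; apply: subset_card_le => _ [al Ial <-]; exact: gS.
Qed.
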